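(* There exist a constant $c>0$ and an infinite sequence of instances $(A,B,u)$, with $A,B\subseteq\mathbb{N}$ finite, $u\in\mathbb{N}$, and $\mathrm{out}:=|(A+B)\cap[u]|$ unbounded along the sequence, such that for every instance in the sequence every rectangle covering of $(A,B,[u])$ has cost at least $c\cdot\mathrm{out}^{1.047}$.
   Context: For an integer $x\ge0$, $[x]=\{0,1,\dots,x\}$. Write $A=\{a_1<\dots<a_n\}$, $B=\{b_1<\dots<b_m\}$ and $A_I=\{a_i:i\in I\}$, $B_J=\{b_j:j\in J\}$. A covering of $(A,B,T)$ is a family $\mathcal{C}$ of pairs $(I,J)$, $I\subseteq\{1..n\}$, $J\subseteq\{1..m\}$, such that every $(i,j)$ with $a_i+b_j\in T$ lies in some $I\times J$ with $(I,J)\in\mathcal{C}$; it is a rectangle covering if all $I,J$ are intervals of consecutive indices; its cost is $\sum_{(I,J)\in\mathcal{C}}|A_I+B_J|$. *)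

(* Defs.v *)
From Stdlib Require Import Reals.
From mathcomp Require Import ssreflect ssrfun ssrbool eqtype ssrnat seq path.


(* Finite sets A ⊆ ℕ are represented by strictly increasing lists
   A = [:: a_1; ...; a_n] (so a_i = nth 0 A (i-1), indices are 0-based here). *)

Definition sumset (X Y : seq nat) : seq nat :=
  undup [seq x + y | x <- X, y <- Y].

(* out := |(A + B) ∩ [u]|, with [u] = {0,...,u} *)
Definition out (A B : seq nat) (u : nat) : nat :=
  size [seq s <- sumset A B | s <= u].

Definition slice (A : seq nat) (i1 i2 : nat) : seq nat :=
  [seq nth 0 A i | i <- iota i1 (i2.+1 - i1)].

(* A rectangle ((i1,i2),(j1,j2)) stands for the pair (I,J) with
   I = {i1..i2}, J = {j1..j2} (0-based index intervals). *)
Definition rect := ((nat * nat) * (nat * nat))%type.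

Definition is_rect_covering (A B : seq nat) (u : nat) (C : seq rect) : Prop :=
  uniq C /\
  (forall r, r \in C ->
     r.1.1 <= r.1.2 < size A /\ r.2.1 <= r.2.2 < size B) /\
  (forall i j, i < size A -> j < size B ->
     nth 0 A i + nth 0 B j <= u ->
     exists r, r \in C /\ r.1.1 <= i <= r.1.2 /\ r.2.1 <= j <= r.2.2).

Definition cost (A B : seq nat) (C : seq rect) : nat :=
  sumn [seq size (sumset (slice A r.1.1 r.1.2) (slice B r.2.1 r.2.2)) | r <- C].

(* real power x^y with the convention 0^y = 0 (y > 0 in our use) *)
Definition rpow (x y : R) : R := if Rle_dec x 0%R then 0%R else Rpower x y.

(* Main.v *)
Require Import Defs.
From Stdlib Require Import Reals.
From mathcomp Require Import ssreflect ssrfun ssrbool eqtype ssrnat seq path.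
From mathcomp Require Import choice div bigop.
From mathcomp Require Import zify.
From Stdlib Require Import Lra.

(** The instance stacks g = 2^t blocks indexed by binary words c_0, ..., c_{g-1}
    of length m = 5t.  Block i of A is a copy of SA(c_i) at offset i together
    with a second copy shifted by i + 1; block i of B is a copy of SB(c_i) at
    offset g - i.  A base-25 digit of SA(c) + SB(d) takes 16 values where the
    words agree (the same 16 for both letters) and 7 where they differ.  Hence
    the sums with equal indices and no shift (the critical ones, just below u)
    form one common set V of size 16^m, while choosing the words greedily makes
    the sums with i < j contribute at most 16^m more; so out <= 2 * 16^m.

    For the cost, assign each of the g * 16^m pairs (i, v), where v in V is the
    critical sum of block i, to a rectangle covering it.  If that rectangle also
    reaches a later block then it contains the shifted copy of the A-part, so it
    pays for the shifted sum, which lies above u and determines (i, v); otherwise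
    i is its last block and it pays for v itself.  So the pairs assigned to a
    rectangle inject into its sumset, and every covering costs at least g * 16^m. *)

(** * Slices of sorted lists, and sumsets *)

Lemma mem_slice A i1 i2 x : i2 < size A -> sorted ltn A ->
  (x \in slice A i1 i2) = [&& x \in A, i1 <= index x A & index x A <= i2].
Proof.
move=> i2A sA; have uA : uniq A by exact: sorted_uniq ltn_trans ltnn _ sA.
apply/mapP/and3P=> [[i] | [xA le1 le2]].
  rewrite mem_iota => /andP[le1 lt2] ->.
  have iA : i < size A by lia.
  by rewrite mem_nth // index_uniq //; split=> //; lia.
by exists (index x A); rewrite ?nth_index // mem_iota; lia.
Qed.

(** On a sorted list [index] is monotone, so an interval of indices is convex in value. This forces
    a rectangle reaching two blocks of A to contain everything of A between them. *)
Lemma slice_convex A i1 i2 x y z : i2 < size A -> sorted ltn A ->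
  x \in slice A i1 i2 -> z \in slice A i1 i2 -> y \in A -> x <= y <= z ->
  y \in slice A i1 i2.
Proof.
move=> i2A sA.
have mono p q : p \in A -> q \in A -> p <= q -> index p A <= index q A.
  move=> pA qA; apply: contraTT; rewrite -!ltnNge => lt.
  exact: (sorted_ltn_index ltn_trans sA q p qA pA lt).
rewrite !mem_slice // => /and3P[xA l1 l2] /and3P[zA l3 l4] yA /andP[xy yz].
by rewrite yA (leq_trans l1 (mono _ _ xA yA xy)) (leq_trans (mono _ _ yA zA yz) l4).
Qed.

Lemma mem_sumset X Y x y : x \in X -> y \in Y -> x + y \in sumset X Y.
Proof. by move=> xX yY; rewrite mem_undup; apply: allpairs_f. Qed.

Lemma sumsetP X Y s :
  reflect (exists x y, [/\ x \in X, y \in Y & s = x + y]) (s \in sumset X Y).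
Proof.
rewrite mem_undup; apply: (iffP allpairsP) => [[[x y] /= [xX yY ->]] | [x [y [xX yY ->]]]].
  by exists x, y.
by exists (x, y).
Qed.

(** * Base-25 digit sets and their sums *)

Fixpoint numerals (ds : seq (seq nat)) : seq nat :=
  if ds is d :: ds' then [seq y + 25 * z | y <- d, z <- numerals ds'] else [:: 0].

(** The two sets are complementary: added to each other they give 0 to 15 once each, while either
    one added to itself has only 7 values. No digit sum exceeds 24, whence base 25. *)
Definition dA (b : bool) : seq nat :=
  if b then [:: 0; 1; 2; 3] else [:: 0; 4; 8; 12].

Definition dB (b : bool) : seq nat := dA (~~ b).

Definition SA (c : seq bool) : seq nat := numerals (map dA c).

Definition SB (c : seq bool) : seq nat := numerals (map dB c).

Fixpoint dS (c x : seq bool) : seq (seq nat) :=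
  if c is b :: c' then
    if x is d :: x' then sumset (dA b) (dB d) :: dS c' x' else [::]
  else [::].

Fixpoint weight (c x : seq bool) : nat :=
  if c is b :: c' then
    if x is d :: x' then (if b == d then 16 else 7) * weight c' x' else 1
  else 1.

Lemma numerals_cons d ds :
  numerals (d :: ds) = [seq y + 25 * z | y <- d, z <- numerals ds].
Proof. by []. Qed.

Lemma size_numerals ds : size (numerals ds) = \prod_(d <- ds) size d.
Proof.
by elim: ds => [|d ds IH]; rewrite ?big_nil // big_cons numerals_cons size_allpairs IH.
Qed.

Lemma size_numerals_dS c x : size (numerals (dS c x)) = weight c x.
Proof.
rewrite size_numerals.
elim: c x => [|b c IH] [|d x]; rewrite ?big_nil //= big_cons IH.
by case: b d => [] [].
Qed.

Lemma SA_SB_sum c x a b : size c = size x -> a \in SA c -> b \in SB x ->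
  a + b \in numerals (dS c x).
Proof.
rewrite /SA /SB; elim: c x a b => [|p c IH] [|d x] a b //=.
  by move=> _; rewrite !inE => /eqP-> /eqP->.
case=> sz /allpairsP[[y z] /= [yp zc ->]] /allpairsP[[y' z'] /= [yd zx ->]].
have -> : y + 25 * z + (y' + 25 * z') = (y + y') + 25 * (z + z') by lia.
by apply: allpairs_f; [exact: mem_sumset | exact: IH].
Qed.

Lemma numerals_lt ds v : all (all (geq 24)) ds -> v \in numerals ds -> v < 25 ^ size ds.
Proof.
elim: ds v => [|d ds IH] v /=; first by rewrite inE => _ /eqP->.
case/andP=> /allP dP dsP /allpairsP[[y z] /= [yd zds ->]].
have /= := dP _ yd; have := IH _ dsP zds; rewrite expnS; lia.
Qed.

Lemma SA_SB_sum_lt c x a b : size c = size x -> a \in SA c -> b \in SB x ->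
  a + b < 25 ^ size c.
Proof.
move=> sz aA bB; have := SA_SB_sum _ _ _ _ sz aA bB.
have -> : size c = size (dS c x) by elim: c x sz {aA bB} => [|p c IH] [|d x] //= [/IH->].
apply: numerals_lt; elim: c x {a b aA bB sz} => [|p c IH] [|d x] //=.
by rewrite IH andbT; case: p d => [] [].
Qed.

(* For either letter, dA b + dB b = {0, ..., 15} without repetition. *)
Definition V m := numerals (nseq m (iota 0 16)).

Lemma size_V m : size (V m) = 16 ^ m.
Proof. by rewrite size_numerals big_nseq iter_muln_1 size_iota. Qed.

Lemma uniq_V m : uniq (V m).
Proof.
elim: m => // m IH.
rewrite /V -[nseq m.+1 _]/(iota 0 16 :: nseq m _) numerals_cons.
apply: allpairs_uniq => [||]; [exact: iota_uniq | exact: IH |].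
move=> yz yz' /allpairsP[[p q] [pI _ ->]] /allpairsP[[p' q'] [pI' _ ->]] /=.
by move: pI pI'; rewrite !mem_iota /= => *; congr pair; lia.
Qed.

(** The right side depends on [c], the left only on its length: this is what makes the critical sums
    of all blocks coincide. *)
Lemma SA_SB_V c v : (v \in V (size c)) = has (fun a => has (fun b => a + b == v) (SB c)) (SA c).
Proof.
have same b y : (y \in iota 0 16) = (y \in sumset (dA b) (dB b)).
  (* The values 0 to 15 are checked one by one; anything larger lies in neither list. *)
  by rewrite mem_undup !mem_iota; case: b; do 16 (case: y => // y).
apply/idP/hasP.
  rewrite /SA /SB; elim: c v => [|p c IH] v /=.
    by rewrite inE => /eqP->; exists 0.
  case/allpairsP=> [[y z] /= [+ /IH[a aA /hasP[b bB /eqP<-]] ->]].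
  rewrite (same p) => /sumsetP[y1 [y2 [y1A y2B ->]]].
  exists (y1 + 25 * a); first exact: allpairs_f.
  by apply/hasP; exists (y2 + 25 * b); [exact: allpairs_f | lia].
case=> a aA /hasP[b bB /eqP<-].
have := SA_SB_sum c c a b erefl aA bB.
move: (a + b) => w {v a b aA bB}; elim: c w => //= p c IH v /allpairsP[[y z] /= [yS zS ->]].
by apply: allpairs_f; [rewrite (same p) | exact: IH].
Qed.

(** * Greedy choice of the words *)

Fixpoint words m : seq (seq bool) :=
  if m is m'.+1 then map (cons true) (words m') ++ map (cons false) (words m')
  else [:: [::]].

Lemma size_words m : size (words m) = 2 ^ m.
Proof. by elim: m => //= m IH; rewrite size_cat !size_map IH expnS; lia. Qed.

Lemma words_size m c : c \in words m -> size c = m.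
Proof.
elim: m c => [|m IH] c /=; first by rewrite inE => /eqP->.
by rewrite mem_cat => /orP[] /mapP[c' /IH <- ->].
Qed.

(** The sum factors over positions; at each one, one letter agrees with [x] and the other does not,
    giving 16 + 7 = 23. *)
Lemma sum_weight m x : size x = m -> \sum_(c <- words m) weight c x = 23 ^ m.
Proof.
elim: m x => [|m IH] [|d x] //= => [_|[sz]]; first by rewrite big_seq1.
rewrite big_cat !big_map /= -!big_distrr /= IH // expnS.
by case: d => /=; lia.
Qed.

Lemma averaging (T : eqType) (s : seq T) (F : T -> nat) N :
  0 < size s -> \sum_(c <- s) F c <= N -> exists2 c, c \in s & size s * F c <= N.
Proof.
move=> s0 sN; apply/hasP; apply: contraLR sN => /hasPn no; rewrite -ltnNge.
rewrite -(ltn_pmul2l s0) big_distrr /=.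
have -> : size s * N = \sum_(c <- s) N by rewrite big_const_seq count_predT iter_addn_0 mulnC.
have : \sum_(c <- s) N.+1 <= \sum_(c <- s) size s * F c.
  rewrite !big_seq; apply: leq_sum => c /no; lia.
rewrite !big_const_seq !count_predT !iter_addn_0; lia.
Qed.

(** Only [i < j] is counted, as sums with [i > j] exceed [bound]. The factor 2 that accompanies it
    later stands for the two copies in each block of A. *)
Definition offdiag (cs : seq (seq bool)) : nat :=
  \sum_(0 <= i < size cs) \sum_(i.+1 <= j < size cs)
    weight (nth [::] cs i) (nth [::] cs j).

Lemma offdiag_cons c cs : offdiag (c :: cs) = \sum_(x <- cs) weight c x + offdiag cs.
Proof.
rewrite /offdiag big_nat_recl //= big_add1 /= (big_nth [::]); congr (_ + _).
by apply: eq_bigr => i _; rewrite big_add1.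
Qed.

(* Greedy choice: over all words the weight against a fixed word averages
   (23/2)^m, so some word is at most average against those already chosen. *)
Lemma exists_code m n : exists cs,
  [&& size cs == n, all (fun c => size c == m) cs & 2 ^ m * (2 * offdiag cs) <= n ^ 2 * 23 ^ m].
Proof.
elim: n => [|n [cs /and3P[/eqP scs /allP acs IH]]].
  by exists [::]; rewrite /offdiag big_geq // !muln0.
have total : \sum_(c <- words m) \sum_(x <- cs) weight c x <= n * 23 ^ m.
  rewrite exchange_big /= -scs -sum1_size big_distrl /= !big_seq.
  by apply: leq_sum => x /acs/eqP xm; rewrite sum_weight // mul1n.
have [|c cw] := averaging _ _ _ _ _ total; rewrite size_words ?expn_gt0 // => cle.
exists (c :: cs); rewrite /= scs (words_size _ _ cw) !eqxx offdiag_cons /=.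
(* The new word adds at most [2 * n * 23 ^ m] to the left side, and [n ^ 2 + 2 * n <= n.+1 ^ 2]. *)
apply/andP; split; [exact/allP | nia].
Qed.

Definition code m n : seq (seq bool) := xchoose (exists_code m n).

Lemma codeP m n :
  [/\ size (code m n) = n, all (fun c => size c == m) (code m n) &
     2 ^ m * (2 * offdiag (code m n)) <= n ^ 2 * 23 ^ m].
Proof. by have /and3P[/eqP] := xchooseP (exists_code m n). Qed.

(** * The sets A and B and the threshold *)

(** In units of [25 ^ m], blocks are [(size cs).+1] apart and the shift [i.+1] is at most [size cs],
    so the shifted copy stays before the next block. The shifts differ from block to block, so a
    shift identifies its block. *)
Definition blockA m cs i :=
  [seq (i * (size cs).+1 + e) * 25 ^ m + a | e <- [:: 0; i.+1], a <- SA (nth [::] cs i)].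

Definition blockB m cs i :=
  [seq (size cs - i) * (size cs).+1 * 25 ^ m + b | b <- SB (nth [::] cs i)].

Definition setA m cs : seq nat :=
  sort leq (undup (flatten [seq blockA m cs i | i <- iota 0 (size cs)])).

Definition setB m cs : seq nat :=
  sort leq (undup (flatten [seq blockB m cs i | i <- iota 0 (size cs)])).

(** The largest number whose quotient by [25 ^ m] is that of the critical sums; one more unit
    exceeds it. *)
Definition bound m (cs : seq (seq bool)) : nat :=
  size cs * (size cs).+1 * 25 ^ m + (25 ^ m).-1.

Lemma sorted_sort_undup s : sorted ltn (sort leq (undup s)).
Proof. by rewrite ltn_sorted_uniq_leq sort_uniq undup_uniq sort_sorted //; exact: leq_total. Qed.

Lemma setAP m cs x : reflect
  (exists i e a, [/\ i < size cs, e \in [:: 0; i.+1], a \in SA (nth [::] cs i) &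
     x = (i * (size cs).+1 + e) * 25 ^ m + a]) (x \in setA m cs).
Proof.
rewrite mem_sort mem_undup; apply: (iffP flatten_mapP).
  by case=> i; rewrite mem_iota => /andP[_ ic] /allpairsP[[e a] /= [eI aA ->]]; exists i, e, a.
case=> i [e [a [ic eI aA ->]]]; exists i; first by rewrite mem_iota.
by apply/allpairsP; exists (e, a).
Qed.

Lemma setBP m cs x : reflect
  (exists i b, [/\ i < size cs, b \in SB (nth [::] cs i) &
     x = (size cs - i) * (size cs).+1 * 25 ^ m + b]) (x \in setB m cs).
Proof.
rewrite mem_sort mem_undup; apply: (iffP flatten_mapP).
  by case=> i; rewrite mem_iota => /andP[_ ic] /mapP[b bB ->]; exists i, b.
case=> i [b [ic bB ->]]; exists i; first by rewrite mem_iota.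
by apply/mapP; exists b.
Qed.

Definition critical_sums m (cs : seq (seq bool)) :=
  [seq size cs * (size cs).+1 * 25 ^ m + v | v <- V m].

(** Repetitions are harmless, since the length serves only as an upper bound. *)
Definition lower_sums m cs :=
  flatten [seq flatten [seq [seq ((size cs + i - j) * (size cs).+1 + e) * 25 ^ m + v
                              | e <- [:: 0; i.+1], v <- numerals (dS (nth [::] cs i) (nth [::] cs j))]
                         | j <- index_iota i.+1 (size cs)]
           | i <- index_iota 0 (size cs)].

Lemma size_flatten_map (T S : Type) (f : T -> seq S) s :
  size (flatten [seq f x | x <- s]) = \sum_(x <- s) size (f x).
Proof. by rewrite size_flatten sumnE /shape !big_map. Qed.

Lemma size_lower_sums m cs : size (lower_sums m cs) = 2 * offdiag cs.
Proof.
rewrite size_flatten_map big_distrr; apply: eq_bigr => i _.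
rewrite size_flatten_map big_distrr; apply: eq_bigr => j _.
by rewrite size_allpairs size_numerals_dS.
Qed.

(** * Counting the sums up to the threshold *)

Section Instance.

Context (m : nat) (cs : seq (seq bool)).
Context (cs_m : all (fun c => size c == m) cs).

Lemma size_nth_code i : i < size cs -> size (nth [::] cs i) = m.
Proof. by move=> ic; apply/eqP; apply: (allP cs_m); exact: mem_nth. Qed.

Lemma V_lt v : v \in V m -> v < 25 ^ m.
Proof.
move=> vV; rewrite -[X in 25 ^ X](size_nseq m (iota 0 16)).
by apply: numerals_lt vV; rewrite all_nseq orbT.
Qed.

Lemma out_le : out (setA m cs) (setB m cs) (bound m cs) <= 16 ^ m + 2 * offdiag cs.
Proof.
rewrite -size_V -(size_map (fun v => size cs * (size cs).+1 * 25 ^ m + v)).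
rewrite -(size_lower_sums m) -size_cat.
apply: uniq_leq_size; first by rewrite filter_uniq // undup_uniq.
move=> s; rewrite mem_filter => /andP[su /sumsetP[x [y [/setAP[i [e [a [ic eI aA ->]]]] /setBP[j [b [jc bB ->]]] def_s]]]].
have ab : a + b < 25 ^ m.
  by rewrite -(size_nth_code i ic); apply: SA_SB_sum_lt bB; rewrite // !size_nth_code.
have es : s = ((size cs + i - j) * (size cs).+1 + e) * 25 ^ m + (a + b).
  rewrite def_s.
  have -> : size cs + i - j = i + (size cs - j) by lia.
  by rewrite !mulnDl; lia.
(* Both low parts are below [25 ^ m], so the comparison passes to quotients. *)
have pos : (size cs + i - j) * (size cs).+1 + e <= size cs * (size cs).+1.
  rewrite -ltnS -(ltn_pmul2r (expn_gt0 25 m)) mulSn.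
  move: su; rewrite es /bound; lia.
(* For [i > j] the quotient would be at least [(size cs).+1 ^ 2]. *)
have le_ij : i <= j by nia.
rewrite mem_cat; apply/orP; case: (eqVneq i j) => [eij | neij]; [left | right].
  have e0 : e = 0 by move: pos; rewrite eij addnK; lia.
  rewrite es e0 eij addnK addn0; apply: map_f.
  rewrite -(size_nth_code i ic) SA_SB_V; apply/hasP; exists a => //.
  by apply/hasP; exists b; rewrite // eij.
apply/flatten_mapP; exists i; first by rewrite mem_index_iota.
apply/flatten_mapP; exists j; first by rewrite mem_index_iota ltn_neqAle neij le_ij.
rewrite es; apply/allpairsP; exists (e, a + b); split=> //=.
by apply: SA_SB_sum => //; rewrite !size_nth_code.
Qed.

Lemma corner_in_sets i v : i < size cs -> v \in V m -> exists a b,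
  [/\ a \in SA (nth [::] cs i), b \in SB (nth [::] cs i) & a + b = v].
Proof.
move=> ic; rewrite -{1}(size_nth_code i ic) SA_SB_V => /hasP[a aA /hasP[b bB /eqP ab]].
by exists a, b.
Qed.

Lemma mem_setA i e a : i < size cs -> e \in [:: 0; i.+1] -> a \in SA (nth [::] cs i) ->
  (i * (size cs).+1 + e) * 25 ^ m + a \in setA m cs.
Proof. by move=> *; apply/setAP; exists i, e, a. Qed.

Lemma mem_setB i b : i < size cs -> b \in SB (nth [::] cs i) ->
  (size cs - i) * (size cs).+1 * 25 ^ m + b \in setB m cs.
Proof. by move=> *; apply/setBP; exists i, b. Qed.

(** The offsets of the two blocks add up to [size cs], so the position of the sum does not depend on
    [i]. *)
Lemma corner_sum i e a b : i < size cs ->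
  (i * (size cs).+1 + e) * 25 ^ m + a + ((size cs - i) * (size cs).+1 * 25 ^ m + b) =
  (size cs * (size cs).+1 + e) * 25 ^ m + (a + b).
Proof.
move=> ic; have {3}-> : size cs = i + (size cs - i) by lia.
by rewrite !mulnDl; lia.
Qed.

(** Block 0 alone already realises every critical sum. This makes [out] unbounded. *)
Lemma out_ge : 0 < size cs -> 16 ^ m <= out (setA m cs) (setB m cs) (bound m cs).
Proof.
move=> c0; rewrite -size_V -(size_map (fun v => size cs * (size cs).+1 * 25 ^ m + v)).
apply: uniq_leq_size; first by rewrite map_inj_uniq ?uniq_V //; exact: addnI.
move=> _ /mapP[v vV ->]; have vlt := V_lt _ vV.
rewrite mem_filter; apply/andP; split; first by rewrite /bound; lia.
have [a [b [aA bB <-]]] := corner_in_sets 0 v c0 vV.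
rewrite -[X in X * 25 ^ m]addn0 -(corner_sum 0) //.
by apply: mem_sumset; [exact: mem_setA | exact: mem_setB].
Qed.

(** * The cost of a rectangle covering *)

Definition covers (r : rect) (p : nat * nat) : bool :=
  has (fun a => has (fun b =>
    [&& a + b == p.2,
        p.1 * (size cs).+1 * 25 ^ m + a \in slice (setA m cs) r.1.1 r.1.2 &
        (size cs - p.1) * (size cs).+1 * 25 ^ m + b \in slice (setB m cs) r.2.1 r.2.2])
    (SB (nth [::] cs p.1))) (SA (nth [::] cs p.1)).

Definition corners : seq (nat * nat) := [seq (i, v) | i <- iota 0 (size cs), v <- V m].

Lemma mem_corners p : (p \in corners) = (p.1 < size cs) && (p.2 \in V m).
Proof.
apply/allpairsP/andP => [[q [+ qV ->]] | [pc pV]]; first by rewrite mem_iota.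
by exists p; rewrite mem_iota; case: p pc pV.
Qed.

Lemma uniq_corners : uniq corners.
Proof.
by apply: allpairs_uniq => [||[? ?] [? ?] _ _]; rewrite ?iota_uniq ?uniq_V.
Qed.

Lemma size_corners : size corners = size cs * 16 ^ m.
Proof. by rewrite size_allpairs size_iota size_V. Qed.

(** Serves both cases of the injection: [e = 0] for the last block reached, [e = p.1.+1] for an
    earlier one. *)
Lemma covers_sum r p e : p.1 < size cs -> e \in [:: 0; p.1.+1] -> covers r p ->
  (forall a, a \in SA (nth [::] cs p.1) ->
    p.1 * (size cs).+1 * 25 ^ m + a \in slice (setA m cs) r.1.1 r.1.2 ->
    (p.1 * (size cs).+1 + e) * 25 ^ m + a \in slice (setA m cs) r.1.1 r.1.2) ->
  (size cs * (size cs).+1 + e) * 25 ^ m + p.2 \in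
    sumset (slice (setA m cs) r.1.1 r.1.2) (slice (setB m cs) r.2.1 r.2.2).
Proof.
move=> pc eI /hasP[a aA /hasP[b bB /and3P[/eqP<- aI bJ]]] shift.
by rewrite -(corner_sum p.1) //; apply: mem_sumset => //; exact: shift.
Qed.

Lemma covers_le r : r.1.2 < size (setA m cs) -> r.2.2 < size (setB m cs) ->
  count (covers r) corners <=
  size (sumset (slice (setA m cs) r.1.1 r.1.2) (slice (setB m cs) r.2.1 r.2.2)).
Proof.
move=> rA rB; set E := [seq p <- corners | covers r p].
pose later (p : nat * nat) := has (fun p' => p.1 < p'.1) E.
pose f p := (size cs * (size cs).+1 + (if later p then p.1.+1 else 0)) * 25 ^ m + p.2.
have memE p : p \in E -> [/\ p.1 < size cs, p.2 < 25 ^ m & covers r p].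
  by rewrite mem_filter mem_corners => /and3P[? ? /V_lt].
rewrite -size_filter -(size_map f); apply: uniq_leq_size.
  rewrite map_inj_in_uniq ?filter_uniq ?uniq_corners // => p p' pE pE'.
  have [pc plt _] := memE _ pE; have [pc' plt' _] := memE _ pE'.
  move=> eqf; have W0 : 0 < 25 ^ m by rewrite expn_gt0.
  (* The residue modulo [25 ^ m] recovers [v]; the quotient then recovers the shift. *)
  have eq2 : p.2 = p'.2.
    by have := congr1 (modn^~ (25 ^ m)) eqf; rewrite /f !modnMDl !modn_small.
  have : (if later p then p.1.+1 else 0) = (if later p' then p'.1.+1 else 0).
    move/eqP: eqf; rewrite /f eq2 eqn_add2r eqn_pmul2r // eqn_add2l; exact/eqP.
  (* A nonzero shift [i.+1] determines [i]. Pairs with shift 0 all have the largest block index in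
     [E], hence the same one. *)
  suff: ~~ later p -> ~~ later p' -> p.1 = p'.1.
    case: p p' eq2 {pE pE' pc plt pc' plt' eqf} => i v [i' v'] /= ->.
    case: (later _); case: (later _) => //=; first by move=> _ [->].
    by move=> /(_ isT isT) ->.
  move=> /hasPn np /hasPn np'; apply/eqP; rewrite eqn_leq.
  by rewrite leqNgt np' //= leqNgt np.
move=> _ /mapP[p pE ->]; have [pc plt pr] := memE _ pE; rewrite /f.
case: ifP => [/hasP[p' pE' lt] | _]; apply: covers_sum => //; last by move=> a _; rewrite addn0.
  by rewrite !inE eqxx orbT.
move=> a aA aI; have [pc' plt' /hasP[a' aA' /hasP[b' bB' /and3P[/eqP ab' aI' _]]]] := memE _ pE'.
(* The shifted element lies between the unshifted one and an element of the later block [p'.1], both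
   in the slice. *)
apply: (slice_convex _ _ _ _ _ _ rA (sorted_sort_undup _) aI aI').
  by apply: mem_setA => //; rewrite !inE eqxx orbT.
(* This [b] serves only to bound [a] by [25 ^ m]. *)
have [b [bB ab]] : exists b, b \in SB (nth [::] cs p.1) /\ a + b < 25 ^ m.
  case/hasP: pr => a0 a0A /hasP[b bB _]; exists b; split=> //.
  by rewrite -(size_nth_code p.1 pc); apply: SA_SB_sum_lt bB.
(* Holds because [p.1.+2 <= (size cs).+1]. The extra unit on the left absorbs [a]. *)
have le1 : (p.1 * (size cs).+1 + p.1.+1).+1 <= p'.1 * (size cs).+1.
  have lt' : p.1.+1 <= p'.1 by [].
  apply: leq_trans (leq_mul lt' (leqnn _)); rewrite mulSn addnC.
  by rewrite -addSn leq_add2r (leqW (leq_ltn_trans lt' pc')).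
apply/andP; split; first by rewrite leq_add2r leq_mul2r leq_addr orbT.
apply: leq_trans (leq_addr a' _); apply: leq_trans (leq_mul le1 (leqnn (25 ^ m))).
by rewrite mulSn addnC leq_add2r (leq_trans (leq_addr b a) (ltnW ab)).
Qed.

(** Double counting of incidences between rectangles and corners: each rectangle pays for its
    corners by [covers_le], and each corner lies in some rectangle because its sum is within
    [bound]. *)
Lemma cost_ge C : is_rect_covering (setA m cs) (setB m cs) (bound m cs) C ->
  size cs * 16 ^ m <= cost (setA m cs) (setB m cs) C.
Proof.
case=> _ [Cr Ccov]; rewrite -size_corners /cost sumnE big_map.
apply: (@leq_trans (\sum_(r <- C) count (covers r) corners)); last first.
  rewrite !big_seq; apply: leq_sum => r /Cr[/andP[_ rA] /andP[_ rB]].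
  exact: covers_le.
under eq_bigr => r _ do rewrite -sum1_count big_mkcond.
rewrite exchange_big /= -sum1_size !big_seq; apply: leq_sum => p.
rewrite mem_corners => /andP[pc pV]; have [a [b [aA bB ab]]] := corner_in_sets _ _ pc pV.
have xA := mem_setA _ 0 _ pc (mem_head _ _) aA; have yB := mem_setB _ _ pc bB.
move: xA; rewrite addn0 => xA.
have sum_le : p.1 * (size cs).+1 * 25 ^ m + a + ((size cs - p.1) * (size cs).+1 * 25 ^ m + b)
    <= bound m cs.
  rewrite -[X in X * _ + a]addn0 corner_sum // ab /bound; have := V_lt _ pV; lia.
have := xA; have := yB; rewrite -!index_mem => yI xI.
have [|r [rC [rI rJ]]] := Ccov _ _ xI yI; first by rewrite !nth_index.
have [/andP[_ rA] /andP[_ rB]] := Cr _ rC.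
rewrite (big_rem r) //=; suff -> : covers r p by [].
apply/hasP; exists a => //; apply/hasP; exists b => //.
by rewrite ab eqxx !mem_slice ?sorted_sort_undup // xA yB rI rJ.
Qed.

End Instance.

(** * Choice of parameters and passage to real exponents *)

Definition instanceA t := setA (5 * t) (code (5 * t) (2 ^ t)).

Definition instanceB t := setB (5 * t) (code (5 * t) (2 ^ t)).

Definition instance_bound t := bound (5 * t) (code (5 * t) (2 ^ t)).

Lemma expn16 t : 16 ^ (5 * t) = 2 ^ (20 * t).
Proof. by rewrite -[16]/(2 ^ 4) -expnM; congr expn; lia. Qed.

Lemma instance_out_ge t :
  2 ^ (20 * t) <= out (instanceA t) (instanceB t) (instance_bound t).
Proof.
have [scs mcs _] := codeP (5 * t) (2 ^ t).
by rewrite -expn16 out_ge // scs expn_gt0.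
Qed.

Lemma instance_out_le t :
  out (instanceA t) (instanceB t) (instance_bound t) <= 2 ^ (20 * t).+1.
Proof.
have [_ mcs off] := codeP (5 * t) (2 ^ t).
apply: leq_trans (out_le _ _ mcs) _.
move: (code _ _) off {mcs} => cs off.
rewrite expnS -expn16 [2 * 16 ^ _]mul2n -addnn leq_add2l.
have pos : 0 < 2 ^ (5 * t) by rewrite expn_gt0.
rewrite -(leq_pmul2l pos); apply: leq_trans off _.
rewrite -expnMn -expnM (mulnC t) !expnM -expnMn.
(* With [2 ^ t] words of length [5 * t], both sides are [t]-th powers, and 25745372 is at most
   33554432. *)
have : 2 ^ 2 * 23 ^ 5 <= (2 * 16) ^ 5 by rewrite !expnS !expn0; lia.
move: (_ * 23 ^ 5) ((2 * 16) ^ 5) => x y xy {pos}.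
by case: t => // t; rewrite leq_exp2r.
Qed.

Lemma instance_cost_ge t C :
  is_rect_covering (instanceA t) (instanceB t) (instance_bound t) C ->
  2 ^ (21 * t) <= cost (instanceA t) (instanceB t) C.
Proof.
have [scs mcs _] := codeP (5 * t) (2 ^ t).
move=> /(cost_ge _ _ mcs); rewrite scs expn16 -expnD.
by have -> : t + 20 * t = 21 * t by lia.
Qed.

Lemma INR_expn2 n : INR (2 ^ n) = Rpower 2 (INR n).
Proof.
rewrite Rpower_pow; last lra.
elim: n => [|n IH]; first by [].
by rewrite expnS -multE mult_INR IH /=.
Qed.

Lemma rpow_le x n y : (0 <= y)%R -> x <= 2 ^ n -> (rpow (INR x) y <= Rpower 2 (y * INR n))%R.
Proof.
move=> y0 /leP/le_INR; rewrite INR_expn2 => xn; rewrite /rpow.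
case: (Rle_dec _ _) => [? | x0] /=; first exact/Rlt_le/exp_pos.
by rewrite Rmult_comm -Rpower_mult; apply: Rle_Rpower_l => //; split=> //; exact: Rnot_le_lt.
Qed.

Theorem mainTheorem5 :
  exists c : R, (0 < c)%R /\
  exists (A B : nat -> seq nat) (u : nat -> nat),
    (forall k, sorted ltn (A k) /\ sorted ltn (B k)) /\
    (forall M : nat, exists k, M <= out (A k) (B k) (u k)) /\
    (forall k (C : seq rect), is_rect_covering (A k) (B k) (u k) C ->
       (c * rpow (INR (out (A k) (B k) (u k))) 1.047 <= INR (cost (A k) (B k) C))%R).
Proof.
(* The cost is at least [2 ^ (21 * k)] and [out] at most [2 ^ (20 * k).+1], so the requirement is
   1.047 (20k + 1) - 2 ≤ 21k, which holds as 1.047 · 20 = 20.94 and 1.047 < 2. *)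
exists (Rpower 2 (-2)); split; first exact: exp_pos.
exists instanceA, instanceB, instance_bound; split; first by split; exact: sorted_sort_undup.
split=> [M | k C /instance_cost_ge/leP/le_INR].
  exists M; apply: leq_trans (instance_out_ge M).
  apply: leq_trans (ltnW (ltn_expl M (ltnSn 1))) _.
  by rewrite leq_exp2l //; lia.
apply: Rle_trans; rewrite INR_expn2.
have r0 : (0 <= 1.047)%R by lra.
apply: Rle_trans (Rmult_le_compat_l _ _ _ _ (rpow_le _ _ _ r0 (instance_out_le k))) _.
  by apply/Rlt_le/exp_pos.
rewrite -Rpower_plus; apply: Rle_Rpower; first lra.
rewrite S_INR -!multE !mult_INR; have := pos_INR k; move: (INR k) => x.
rewrite /=; lra.
Qed.
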